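(* Let $n\ge2$, and for each $l\in\{1,\dots,n\}$ let $S_l$ be a closed symmetric simple linear relation in a Hilbert space $H_l$ and $\Gamma_l\subseteq H_l^2\times\mathbb C^2$ a boundary relation for $S_l^*$. Assume that each $\Gamma_l$ is of function type and that at least one $\Gamma_l$ is a boundary function. Let $m_l$ be the Weyl function of $\Gamma_l$, let $A_l:=\ker[\pi_1\circ\Gamma_l]$, and let $A$ be the selfadjoint relation constructed by pasting $\{\Gamma_l:l=1,\dots,n\}$ with standard interface conditions. Let $x\in\mathbb R$. Then $x\in\sigma_p(A)$ if and only if one of the following two alternatives takes place. (I/II) The point $x$ belongs to at least two of the point spectra $\sigma_p(A_l)$. In this case the multiplicity $N_A(x)$ of the eigenvalue $x$ of $A$ is equal to $$N_A(x)=\#\big\{l\in\{1,\dots,n\}:x\in\sigma_p(A_l)\big\}-1=\#\big\{l\in\{1,\dots,n\}:\lim_{\varepsilon\downarrow0}\varepsilon\operatorname{Im}m_l(x+i\varepsilon)>0\big\}-1 .$$ (III) The limits $m_l(x):=\lim_{\varepsilon\downarrow0}m_l(x+i\varepsilon)$, $l=1,\dots,n$, all exist and are real, $\lim_{\varepsilon\downarrow0}\frac1{i\varepsilon}\big(m_l(x+i\varepsilon)-m_l(x)\big)\in[0,\infty)$ for all $l$, and $\sum_{l=1}^nm_l(x)=0$. In this case $x$ is a simple eigenvalue of $A$.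
   Context: Linear relations. A linear relation is a linear subspace; its elements are written $(f;g)$; operators are identified with their graphs. For a closed symmetric relation $S\subseteq H^2$, $S^*$ is its adjoint; $S$ is simple (completely non-selfadjoint) if there is no orthogonal decomposition $H=H'\oplus H''$, $S=S'\oplus S''$ with $H''\ne\{0\}$ and $S''$ a selfadjoint relation in $H''$. Inner products are linear in the first argument. For a relation $T\subseteq H^2$, $\ker(T-x)=\{f:(f;xf)\in T\}$; $x\in\sigma_p(T)$ means $\ker(T-x)\ne\{0\}$, and the multiplicity of the eigenvalue $x$ is $\dim\ker(T-x)$. Boundary relations. Let $S$ be a closed symmetric linear relation in $H$ and $B$ a Hilbert space. A linear relation $\Gamma\subseteq H^2\times B^2$ is a boundary relation for $S^*$ if: (BR1) the domain of $\Gamma$ is contained in $S^*$ and dense there; (BR2) for all $((f;g);(\alpha;\beta)),((f';g');(\alpha';\beta'))\in\Gamma$ one has $(g,f')_H-(f,g')_H=(\beta,\alpha')_B-(\alpha,\beta')_B$; (BR3) $\Gamma$ is maximal with respect to (BR1) and (BR2). Let $\operatorname{mul}\Gamma=\{(\alpha;\beta)\in B^2:((0;0);(\alpha;\beta))\in\Gamma\}$. $\Gamma$ is of function type if $\operatorname{mul}\Gamma\cap(\{0\}\times B)=\{0\}$, and a boundary function if $\operatorname{mul}\Gamma=\{0\}$. For $z\in\mathbb C\setminus\mathbb R$ put $M(z)=\{(\alpha;\beta)\in B^2:\exists f\in H,\ ((f;zf);(\alpha;\beta))\in\Gamma\}$. If $\Gamma$ is of function type and $B=\mathbb C^k$, then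 $M$ is a $k\times k$-matrix valued Herglotz function (for $k=1$ scalar), called the Weyl function of $\Gamma$. For $\Gamma$ of function type, $\ker[\pi_1\circ\Gamma]:=\{(f;g)\in H^2:\exists\beta\in B,\ ((f;g);(0;\beta))\in\Gamma\}$. Pasting. With $H=\prod_{l=1}^nH_l$, let $\Gamma\subseteq H^2\times(\mathbb C^n)^2$ be the boundary relation consisting of all $$\Big(\big((f_1,\dots,f_n);(g_1,\dots,g_n)\big);\big((-\alpha_1+\alpha_n,\dots,-\alpha_{n-1}+\alpha_n,\ \beta_1+\dots+\beta_n);(-\beta_1,\dots,-\beta_{n-1},-\alpha_n)\big)\Big)$$ with $((f_l;g_l);(\alpha_l;\beta_l))\in\Gamma_l$, $l=1,\dots,n$. The relation obtained by pasting with standard interface conditions is $A:=\ker[\pi_1\circ\Gamma]$; it is a selfadjoint linear relation in $H$. *)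

(* Defs.v *)
From HB Require Import structures.
From mathcomp Require Import all_boot all_order all_algebra.
From mathcomp Require Import sesquilinear complex.
From mathcomp Require Import all_classical all_reals all_analysis.

Set Implicit Arguments.
Unset Strict Implicit.
Unset Printing Implicit Defensive.

Import Order.TTheory GRing.Theory Num.Theory.
Import numFieldNormedType.Exports.

Local Open Scope classical_set_scope.
Local Open Scope complex_scope.
Local Open Scope ring_scope.

(* [dot] is linear in its first argument and conjugate-linear in the second. *)
HB.mixin Record CompleteNormedModule_isHilbert (R : realType) V
    & CompleteNormedModule R[i] V := {
  dot : {dot V for (Num.conj : R[i] -> R[i])};
  sqr_norm_dot : forall x : V, `|x| ^+ 2 = dot x x
}.

#[short(type="hilbertType")]
HB.structure Definition Hilbert (R : realType) :=
  {V of CompleteNormedModule R[i] V & CompleteNormedModule_isHilbert R V}.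

HB.instance Definition _ (R : realType) := NormedModule.copy R[i] R[i]^o.

Section complex_hilbert.
Variable R : realType.
Local Notation C := R[i].

Let normc_ge_Im (z : C) : `|complex.Im z|%:C <= `|z|.
Proof.
by rewrite normc_def lecR -sqrtr_sqr ler_wsqrtr// lerDr sqr_ge0.
Qed.

Let normc_le (z : C) : `|z| <= (`|complex.Re z| + `|complex.Im z|)%:C.
Proof.
rewrite normc_def lecR -[leRHS]ger0_norm ?addr_ge0// -sqrtr_sqr ler_wsqrtr//.
by rewrite sqrrD !real_normK ?num_real// lerD2r lerDl mulrn_wge0 ?mulr_ge0.
Qed.

Lemma complex_complete (F : set_system C) :
  ProperFilter F -> cauchy F -> cvg F.
Proof.
move=> FF /cauchyP Fc.
have Fre : cvg (@complex.Re R @ F).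
  apply: R_complete; apply/cauchyP => e e0.
  have [|x Fx] := Fc e%:C; first by rewrite ltcR.
  exists (complex.Re x); rewrite /nbhs /=; apply: filterS Fx => z.
  rewrite -!ball_normE /ball_ /= -(ltcR _ e); apply: le_lt_trans.
  by rewrite -raddfB normc_ge_Re.
have Fim : cvg (@complex.Im R @ F).
  apply: R_complete; apply/cauchyP => e e0.
  have [|x Fx] := Fc e%:C; first by rewrite ltcR.
  exists (complex.Im x); rewrite /nbhs /=; apply: filterS Fx => z.
  rewrite -!ball_normE /ball_ /= -(ltcR _ e); apply: le_lt_trans.
  by rewrite -raddfB normc_ge_Im.
apply/cvg_ex; exists (lim (@complex.Re R @ F) +i* lim (@complex.Im R @ F)).
apply/cvgrPdist_lt => -[e e'] /[dup] e0; rewrite ltcE /= => /andP[/eqP ->] e1.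
have e2 : 0 < e / 2 by rewrite divr_gt0.
move/cvgrPdist_lt : Fre => /(_ _ e2) Fre.
move/cvgrPdist_lt : Fim => /(_ _ e2) Fim.
near=> z; apply: le_lt_trans (normc_le _) _; rewrite ltcR !raddfB /=.
rewrite [ltRHS]splitr ltrD//; near: z; [exact: Fre|exact: Fim].
Unshelve. all: by end_near. Qed.

HB.instance Definition _ := Uniform_isComplete.Build C complex_complete.

Definition dotc (x y : C) : C := x * Num.conj y.

Let dotc_linl y : linear_for *%R (dotc^~ y).
Proof. by move=> a u v; rewrite /dotc mulrDl mulrA. Qed.

Let dotc_linr x : linear_for (Num.conj \; *%R) (dotc x).
Proof. by move=> a u v; rewrite /dotc /= rmorphD rmorphM /= mulrDr mulrCA. Qed.

HB.instance Definition _ :=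
  bilinear_isBilinear.Build C C C C *%R (Num.conj \; *%R) dotc (dotc_linl, dotc_linr).

Let dotc_herm (x y : C) : dotc x y = (-1) ^+ false * Num.conj (dotc y x).
Proof. by rewrite expr0 mul1r /dotc rmorphM /= conjCK mulrC. Qed.

HB.instance Definition _ :=
  isHermitianSesquilinear.Build C C false Num.conj dotc dotc_herm.

Let dotc_gt0 (x : C) : x != 0 -> 0 < dotc x x.
Proof. by rewrite /dotc mul_conjC_gt0. Qed.

HB.instance Definition _ := isDotProduct.Build C C dotc dotc_gt0.

Let normc_dotc (x : C) : `|x| ^+ 2 = dotc x x.
Proof. exact: normCK. Qed.

HB.instance Definition _ :=
  CompleteNormedModule_isHilbert.Build R C normc_dotc.

End complex_hilbert.

Definition dprod (K : nzRingType) (I : Type) (V : I -> lmodType K) : Type :=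
  forall i, V i.

Section dprod_lmodule.
Variables (K : nzRingType) (I : Type) (V : I -> lmodType K).
Implicit Types f g h : dprod V.

HB.instance Definition _ := Choice.copy (dprod V) (forall i, V i).

Let zero : dprod V := fun i => 0.
Let opp f : dprod V := fun i => - f i.
Let add f g : dprod V := fun i => f i + g i.
Let scale (a : K) f : dprod V := fun i => a *: f i.

Let addA : associative add.
Proof. by move=> f g h; apply/functional_extensionality_dep => i; exact: addrA. Qed.
Let addC : commutative add.
Proof. by move=> f g; apply/functional_extensionality_dep => i; exact: addrC. Qed.
Let add0 : left_id zero add.
Proof. by move=> f; apply/functional_extensionality_dep => i; exact: add0r. Qed.
Let addN : left_inverse zero opp add.
Proof. by move=> f; apply/functional_extensionality_dep => i; exact: addNr. Qed.

HB.instance Definition _ := GRing.isZmodule.Build (dprod V) addA addC add0 addN.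

Let scaleA a b f : scale a (scale b f) = scale (a * b) f.
Proof. by apply/functional_extensionality_dep => i; exact: scalerA. Qed.
Let scale1 : left_id 1 scale.
Proof. by move=> f; apply/functional_extensionality_dep => i; exact: scale1r. Qed.
Let scaleDr : right_distributive scale +%R.
Proof. by move=> a f g; apply/functional_extensionality_dep => i; exact: scalerDr. Qed.
Let scaleDl f : {morph scale^~ f : a b / a + b}.
Proof. by move=> a b; apply/functional_extensionality_dep => i; exact: scalerDl. Qed.

HB.instance Definition _ :=
  GRing.Zmodule_isLmodule.Build K (dprod V) scaleA scale1 scaleDr scaleDl.

End dprod_lmodule.

Section linear_algebra.
Variables (K : nzRingType) (V : lmodType K).

Definition linear_subspace (S : set V) : Prop :=
  S 0 /\ forall (a : K) u v, S u -> S v -> S (a *: u + v).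

Definition has_dim (S : set V) (d : nat) : Prop :=
  exists e : 'I_d -> V,
    (forall c : 'I_d -> K, \sum_i c i *: e i = 0 -> forall i, c i = 0) /\
    S = [set v | exists c : 'I_d -> K, v = \sum_i c i *: e i].

Definition kernel_sub (T : set (V * V)) (x : K) : set V :=
  [set f | T (f, x *: f)].

Definition point_spectrum (T : set (V * V)) : set K :=
  [set x | kernel_sub T x <> [set 0]].

Definition has_multiplicity (T : set (V * V)) (x : K) (d : nat) : Prop :=
  has_dim (kernel_sub T x) d.

End linear_algebra.

Section linear_relations.
Variables (R : realType) (H : hilbertType R).
Implicit Types (S : set (H * H)) (E : set H).

Definition adjoint S : set (H * H) :=
  [set p | forall q, S q -> dot p.2 q.1 = dot p.1 q.2].

Definition closed_symmetric S : Prop :=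
  [/\ linear_subspace S, closed S & S `<=` adjoint S].

(* Closedness of the two summands is automatic, each of them being the
   orthogonal complement of the other. *)
Definition orthogonal_decomposition (E1 E2 : set H) : Prop :=
  [/\ linear_subspace E1, linear_subspace E2,
      forall f g, E1 f -> E2 g -> dot f g = 0 &
      forall h, exists f g, [/\ E1 f, E2 g & h = f + g]].

Definition relation_in E S : Prop :=
  linear_subspace S /\ forall p, S p -> E p.1 /\ E p.2.

Definition selfadjoint_in E S : Prop :=
  relation_in E S /\ S = [set p | [/\ E p.1, E p.2 & adjoint S p]].

Definition simple_relation S : Prop :=
  ~ exists E1 E2 S1 S2,
    [/\ orthogonal_decomposition E1 E2,
        relation_in E1 S1, selfadjoint_in E2 S2,
        S = [set p | exists p1 p2, [/\ S1 p1, S2 p2 & p = p1 + p2]] &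
        E2 <> [set 0]].

End linear_relations.

Section boundary_relations.
Variables (R : realType) (H B : hilbertType R).
Local Notation C := R[i].
Implicit Types (S : set (H * H)) (G : set ((H * H) * (B * B))).

Definition relation_dom G : set (H * H) := [set p | exists q, G (p, q)].

Definition BR1 S G : Prop :=
  relation_dom G `<=` adjoint S /\ adjoint S `<=` closure (relation_dom G).

Definition BR2 G : Prop :=
  forall (f g f' g' : H) (a b a' b' : B),
    G ((f, g), (a, b)) -> G ((f', g'), (a', b')) ->
    dot g f' - dot f g' = dot b a' - dot a b'.

Definition boundary_relation S G : Prop :=
  [/\ linear_subspace G, BR1 S G, BR2 G &
      forall G', linear_subspace G' -> BR1 S G' -> BR2 G' ->
        G `<=` G' -> G' = G].

Definition weyl_family G (z : C) : set (B * B) :=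
  [set q | exists f, G ((f, z *: f), q)].

End boundary_relations.

Section boundary_values.
Variables (K : nzRingType) (V W : lmodType K).
Implicit Types G : set ((V * V) * (W * W)).

Definition mul_part G : set (W * W) := [set q | G (0, q)].

Definition function_type G : Prop :=
  mul_part G `&` [set q | q.1 = 0] = [set 0].

Definition boundary_function G : Prop := mul_part G = [set 0].

Definition ker_pi1 G : set (V * V) := [set p | exists b : W, G (p, (0, b))].

End boundary_values.

(* [M(z)] is identified with the operator of multiplication by [m z], that is,
   it is the graph of [alpha |-> m z * alpha]. *)
Definition weyl_function (R : realType) (H : hilbertType R)
    (G : set ((H * H) * (R[i] * R[i]))) (m : R[i] -> R[i]) : Prop :=
  forall z : R[i], complex.Im z != 0 ->
    weyl_family G z = [set q | q.2 = m z * q.1].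

Section pasting.
Variables (R : realType) (n : nat) (H : 'I_n.+1 -> hilbertType R).
Local Notation C := R[i].

(* The index [ord_max] plays the role of the distinguished last edge. *)
Definition pasting (G : forall l, set ((H l * H l) * (C * C))) :
    set ((dprod H * dprod H) * ('rV[C]_n.+1 * 'rV[C]_n.+1)) :=
  [set p | exists (f g : dprod H) (a b : 'I_n.+1 -> C),
    (forall l, G l ((f l, g l), (a l, b l))) /\
    p = ((f, g),
         (\row_l (if l == ord_max then \sum_k b k else - a l + a ord_max),
          \row_l (if l == ord_max then - a ord_max else - b l)))].

Definition pasted_relation (G : forall l, set ((H l * H l) * (C * C))) :
  set (dprod H * dprod H) := ker_pi1 (pasting G).

End pasting.

(* Main.v *)
Require Import Defs.
From HB Require Import structures.
From mathcomp Require Import all_boot all_order all_algebra.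
From mathcomp Require Import sesquilinear complex.
From mathcomp Require Import all_classical all_reals all_analysis.
From mathcomp Require Import ring lra.

Set Implicit Arguments.
Unset Strict Implicit.
Unset Printing Implicit Defensive.

Import Order.TTheory GRing.Theory Num.Theory.
Import numFieldNormedType.Exports.

Local Open Scope classical_set_scope.
Local Open Scope complex_scope.
Local Open Scope ring_scope.

(** At a point [x +i* e] above [x] each edge has a defect element [F e] with
boundary values [(1, m)]. Green's identity computes all inner products of these
elements from the Weyl function [m]. In particular [sqn (F e) = Im m / e] increases
as [e] decreases to zero and [e Im m = sqn (e F e)] decreases, and in either case
the squared distance of two members of the family is bounded by the difference of
the corresponding values ([monotone_family_cvg]). Hence a finite limit of [Im m / e],
or a positive limit of [e Im m], yields a limit vector, and because a boundary relation is
closed ([br_cvg]) this vector is an eigenvector at [x]. Conversely an eigenvector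
at [x] bounds these quantities through Green's identity and the Cauchy-Schwarz
inequality. This gives, for one edge, the two translations on which the theorem rests:
[x] is in the point spectrum of [ker_pi1 G] if and only if [e Im m] has a positive
limit ([pole_point_spectrum]), and an eigenvector with boundary values [(1, b)]
exists if and only if [m] and its difference quotient have limits [b] and
[d >= 0] ([real_kernel_value]).

What remains is linear algebra. Green's identity on the real axis confines the
boundary values of the eigenvectors of one edge to a real line, and simplicity
makes these values determine the eigenvector: an eigenvector with zero boundary
values would lie in the second adjoint of [S], which is [S] ([biadjoint_closed],
[ker_sub_relation]), and would split off a selfadjoint part
([simple_no_real_eigenvector]). An eigenvector of the pasted relation has a
common first boundary value [a] on all edges, and second boundary values with sum
zero. If some edge has [x] in its point spectrum then [a = 0], only such edges
contribute, and the sum condition cuts their number by one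
([pasted_multiplicity_poles]). If [a] is not zero, then after normalisation the
second boundary values are the limits of the Weyl functions
([pasted_multiplicity_value], [pasted_eigenvalue_cases]). *)

(** * Complex numbers, inner products and convergence *)
Section complex_numbers.
Variable R : realType.
Local Notation C := R[i].
Implicit Types z w : C.

Lemma Re_conjC z : complex.Re (Num.conj z) = complex.Re z.
Proof. by case: z. Qed.

Lemma Im_conjC z : complex.Im (Num.conj z) = - complex.Im z.
Proof. by case: z. Qed.

Lemma conjC_real (a : R) : Num.conj (a%:C) = a%:C.
Proof. by apply/eqP; rewrite eq_complex /= oppr0 !eqxx. Qed.

Lemma complex_eqP z w :
  complex.Re z = complex.Re w -> complex.Im z = complex.Im w -> z = w.
Proof. by case: z w => [a b] [c d] /= -> ->. Qed.

Lemma ReM z w : complex.Re (z * w) =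
  complex.Re z * complex.Re w - complex.Im z * complex.Im w.
Proof. by case: z w => [a b] [c d]. Qed.

Lemma ImM z w : complex.Im (z * w) =
  complex.Re z * complex.Im w + complex.Im z * complex.Re w.
Proof. by case: z w => [a b] [c d]. Qed.

Lemma dot_C z w : dot z w = z * Num.conj w. Proof. by []. Qed.

End complex_numbers.

Section inner_product.
Variables (R : realType) (H : hilbertType R).
Local Notation C := R[i].
Implicit Types (x y z : H) (a : C).

Lemma dotDl x y z : dot (x + y) z = dot x z + dot y z.
Proof. exact: linearDl. Qed.
Lemma dotDr x y z : dot z (x + y) = dot z x + dot z y.
Proof. exact: linearDr. Qed.
Lemma dotNl x z : dot (- x) z = - dot x z.
Proof. exact: linearNl. Qed.
Lemma dotNr x z : dot z (- x) = - dot z x.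
Proof. exact: linearNr. Qed.
Lemma dotZl a x z : dot (a *: x) z = a * dot x z.
Proof. exact: linearZl_LR. Qed.
Lemma dotZr a x z : dot z (a *: x) = Num.conj a * dot z x.
Proof. exact: linearZr_LR. Qed.
Lemma dot0l z : dot 0 z = 0. Proof. exact: linear0l. Qed.
Lemma dot0r z : dot z 0 = 0. Proof. exact: linear0r. Qed.
Lemma dotC x y : dot y x = Num.conj (dot x y).
Proof. by rewrite hermC expr0 mul1r. Qed.

Definition dotE := (dotDl, dotDr, dotNl, dotNr, dotZl, dotZr, dot0l, dot0r).

(** The squared norm as an element of the real field, so that it can be handled
by real arithmetic; the norm of the Hilbert space is complex valued. *)
Definition sqn x : R := complex.Re (dot x x).

Lemma dot_sqn x : dot x x = (sqn x)%:C.
Proof.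
apply: complex_eqP => //=.
have := congr1 (@complex.Im R) (dotC x x); rewrite Im_conjC => /eqP.
by rewrite -addr_eq0 -mulr2n mulrn_eq0 => /eqP.
Qed.

Lemma sqn_ge0 x : 0 <= sqn x.
Proof. by rewrite -ler0c -dot_sqn dnorm_ge0. Qed.

Lemma sqn_eq0 x : (sqn x == 0) = (x == 0).
Proof. by rewrite -(dnorm_eq0 dot x) dot_sqn -(inj_eq (@complexI R)). Qed.

Lemma sqn_gt0 x : (0 < sqn x) = (x != 0).
Proof. by rewrite lt0r sqn_ge0 andbT sqn_eq0. Qed.

Lemma sqnD x y : sqn (x + y) = sqn x + sqn y + 2 * complex.Re (dot x y).
Proof.
rewrite /sqn !dotE (dotC x y) !raddfD /= Re_conjC; ring.
Qed.

Lemma sqnN x : sqn (- x) = sqn x.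
Proof. by rewrite /sqn !dotE opprK. Qed.

Lemma sqnB x y : sqn (x - y) = sqn x + sqn y - 2 * complex.Re (dot x y).
Proof. by rewrite sqnD sqnN dotNr raddfN /=; ring. Qed.

Lemma sqnZ a x : sqn (a *: x) = (complex.Re a ^+ 2 + complex.Im a ^+ 2) * sqn x.
Proof.
rewrite /sqn !dotE !ReM !ImM Re_conjC Im_conjC.
by rewrite dot_sqn /=; ring.
Qed.

Lemma cauchy_schwarz x y :
  complex.Re (dot x y) ^+ 2 + complex.Im (dot x y) ^+ 2 <= sqn x * sqn y.
Proof.
have [->|y0] := eqVneq y 0; first by rewrite /sqn !dot0r /=; nra.
set a := dot x y.
(* The component of [x] orthogonal to [y], multiplied by [sqn y] so that no
   division is needed. *)
have := sqn_ge0 ((sqn y)%:C *: x - a *: y).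
rewrite sqnB !sqnZ dotZl dotZr -/a !ReM !ImM Re_conjC Im_conjC /=.
have s0 : 0 < sqn y by rewrite sqn_gt0.
set L := (X in 0 <= X); set r := complex.Re a; set i := complex.Im a.
have -> : L = sqn y * (sqn x * sqn y - (r ^+ 2 + i ^+ 2)) by rewrite /L; ring.
by rewrite pmulr_rge0// subr_ge0.
Qed.

Lemma normr_sqn x : `|x| = (Num.sqrt (sqn x))%:C.
Proof.
apply/eqP; rewrite -(eqrXn2 (n := 2)) ?ler0c ?sqrtr_ge0// ?normr_ge0//.
by rewrite sqr_norm_dot dot_sqn -rmorphXn /= sqr_sqrtr ?sqn_ge0.
Qed.

Lemma normr_lt_sqn x (e : R) : 0 < e -> (`|x| < e%:C) = (sqn x < e ^+ 2).
Proof.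
move=> e0; rewrite normr_sqn ltcR -[in RHS](sqr_sqrtr (sqn_ge0 x)).
by rewrite ltr_pXn2r// ?nnegrE ?sqrtr_ge0 ?ltW.
Qed.

End inner_product.

Section convergence.
Variables (R : realType) (H : hilbertType R).
Local Notation C := R[i].

Lemma gt0_complex (e : C) : 0 < e -> exists2 d : R, 0 < d & e = d%:C.
Proof.
by case: e => a b; rewrite ltcE /= => /andP[/eqP -> a0]; exists a.
Qed.

Lemma hilbert_cvgP T (Phi : set_system T) {FF : Filter Phi} (F : T -> H) (f : H) :
  F @ Phi --> f <-> sqn (F t - f) @[t --> Phi] --> (0 : R).
Proof.
split=> [/cvgrPdist_lt h|/cvgrPdist_lt h].
  apply/cvgrPdist_lt => e e0.
  have s0 : 0 < Num.sqrt e by rewrite sqrtr_gt0.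
  have := h (Num.sqrt e)%:C; rewrite ltcR => /(_ s0).
  apply: filterS => t; rewrite normr_lt_sqn// sqr_sqrtr ?ltW//.
  by rewrite sub0r normrN ger0_norm ?sqn_ge0// -sqnN opprB.
apply/cvgrPdist_lt => e /gt0_complex[d d0 ->].
have := h (d ^+ 2); rewrite exprn_gt0// => /(_ isT).
apply: filterS => t; rewrite normr_lt_sqn//.
by rewrite sub0r normrN ger0_norm ?sqn_ge0// -sqnN opprB.
Qed.

(** The filter is arbitrary because completeness serves twice: along a filter
of approximate minimisers for the projection theorem, and along [e --> 0^'+] for
the eigenvectors. *)
Lemma hilbert_cauchy T (Phi : set_system T) {FF : ProperFilter Phi} (F : T -> H) :
  (forall e : R, 0 < e -> exists2 A, Phi A &
     forall s t, A s -> A t -> sqn (F s - F t) < e) ->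
  exists f : H, F @ Phi --> f.
Proof.
move=> h; suff c : cvg (F @ Phi) by exists (lim (F @ Phi)).
apply/cauchy_cvgP; apply/cauchyP => e /gt0_complex[d d0 ->].
have [A PA hA] := h (d ^+ 2) (exprn_gt0 _ d0).
have [s As] := filter_ex PA.
exists (F s); change (Phi [set t | ball (F s) d%:C (F t)]).
apply: filterS PA => t At /=.
by rewrite -ball_normE /ball_ /= normr_lt_sqn// hA.
Qed.

Lemma normc_lt (z : C) (e : R) : 0 < e ->
  (`|z| < e%:C) = (complex.Re z ^+ 2 + complex.Im z ^+ 2 < e ^+ 2).
Proof.
have h : 0 <= complex.Re z ^+ 2 + complex.Im z ^+ 2 by rewrite addr_ge0 ?sqr_ge0.
move=> e0; rewrite normc_def ltcR -[in RHS](sqr_sqrtr h).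
by rewrite ltr_pXn2r// ?nnegrE ?sqrtr_ge0 ?ltW.
Qed.

Lemma complex_cvgP T (Phi : set_system T) {FF : Filter Phi} (F : T -> C) (c : C) :
  F @ Phi --> c <->
  (complex.Re (F t) @[t --> Phi] --> complex.Re c) /\
  (complex.Im (F t) @[t --> Phi] --> complex.Im c).
Proof.
split=> [/cvgrPdist_lt h|[/cvgrPdist_lt h1 /cvgrPdist_lt h2]].
  split; apply/cvgrPdist_lt => e e0; have := h e%:C; rewrite ltcR => /(_ e0);
    apply: filterS => t; rewrite normc_lt// !raddfB => ht;
    rewrite -(@ltr_pXn2r _ 2) ?nnegrE ?normr_ge0 ?ltW// real_normK ?num_real//;
    apply: le_lt_trans ht; by rewrite (lerDl, lerDr) sqr_ge0.
apply/cvgrPdist_lt => e /gt0_complex[d d0 ->].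
have d2 : 0 < d / 2 by rewrite divr_gt0.
apply: filterS2 (h1 _ d2) (h2 _ d2) => t a b; rewrite normc_lt// !raddfB.
rewrite -[X in X + _]real_normK ?num_real// -[X in _ + X]real_normK ?num_real//.
have := normr_ge0 (complex.Re c - complex.Re (F t)).
have := normr_ge0 (complex.Im c - complex.Im (F t)).
move: a b; set u := `|_|; set v := `|_|; nra.
Qed.

Lemma dot_cvgl T (Phi : set_system T) {FF : ProperFilter Phi} (F : T -> H) f h :
  F @ Phi --> f -> dot (F t) h @[t --> Phi] --> dot f h.
Proof.
move=> /hilbert_cvgP Ff; apply/complex_cvgP.
have hcs t : complex.Re (dot (F t) h - dot f h) ^+ 2 +
    complex.Im (dot (F t) h - dot f h) ^+ 2 <= sqn (F t - f) * sqn h.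
  by rewrite -dotNl -dotDl cauchy_schwarz.
have B0 : sqn (F t - f) * sqn h @[t --> Phi] --> (0 : R).
  by rewrite -(mul0r (sqn h)); apply: cvgMl.
have key (G : C -> R) : (forall z w, G (z - w) = G z - G w) ->
    (forall z, G z ^+ 2 <= complex.Re z ^+ 2 + complex.Im z ^+ 2) ->
    G (dot (F t) h) @[t --> Phi] --> G (dot f h).
  move=> GB G2; apply/cvgrPdist_lt => e e0.
  move/cvgrPdist_lt : B0 => /(_ _ (exprn_gt0 2 e0)); apply: filterS => t.
  rewrite sub0r normrN ger0_norm; last by rewrite mulr_ge0 ?sqn_ge0.
  move=> /(le_lt_trans (hcs t))/(le_lt_trans (G2 _)); rewrite GB => ht.
  rewrite distrC -(@ltr_pXn2r _ 2) ?nnegrE ?normr_ge0 ?ltW//.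
  by rewrite real_normK ?num_real.
split; apply: key => z; rewrite ?(lerDl, lerDr) ?sqr_ge0// => w; exact: raddfB.
Qed.

Lemma dot_cvgr T (Phi : set_system T) {FF : ProperFilter Phi} (F : T -> H) f h :
  F @ Phi --> f -> dot h (F t) @[t --> Phi] --> dot h f.
Proof.
move=> /(dot_cvgl (h := h)) /complex_cvgP[h1 h2]; apply/complex_cvgP.
rewrite (dotC f h) Re_conjC Im_conjC.
split; [under eq_fun do rewrite dotC Re_conjC; exact: h1|].
under eq_fun do rewrite dotC Im_conjC.
exact: (cvgN h2).
Qed.

Lemma sqn_cvg T (Phi : set_system T) {FF : ProperFilter Phi} (F : T -> H) f :
  F @ Phi --> f -> sqn (F t) @[t --> Phi] --> sqn f.
Proof.
move=> Ff; have /hilbert_cvgP h := Ff.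
have /complex_cvgP[h1 _] : dot (F t) f @[t --> Phi] --> dot f f by exact: dot_cvgl.
have -> : (fun t => sqn (F t)) =
    (fun t => sqn (F t - f) + 2 * complex.Re (dot (F t) f) - sqn f).
  by apply/funext => t; rewrite sqnB; ring.
have {2}-> : sqn f = 0 + 2 * complex.Re (dot f f) - sqn f by rewrite -/(sqn f); ring.
apply: cvgB; last exact: cvg_cst.
by apply: cvgD; [exact: h|apply: cvgM; [exact: cvg_cst|exact: h1]].
Qed.

End convergence.

(** * Closed relations coincide with their second adjoint *)
Section biadjoint.
Variables (R : realType) (H : hilbertType R).
Local Notation C := R[i].
Implicit Types (S : set (H * H)) (p q : H * H).

(** The Hilbertian squared norm of [H * H]: the norm carried by the product
type is the maximum norm, which comes from no inner product. *)
Definition sqn2 p : R := sqn p.1 + sqn p.2.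

(** The sets of approximate minimisers of the distance from [p] shrink, by the
parallelogram law, so they form a Cauchy filter; its limit is the minimiser. *)
Lemma closed_projection S p : linear_subspace S -> closed S ->
  exists2 s, S s & forall t, S t -> sqn2 (p - s) <= sqn2 (p - t).
Proof.
move=> [S0 SL] Scl.
pose D := [set sqn2 (p - t) | t in S].
have D0 : D !=set0 by exists (sqn2 (p - 0)), 0.
have Dlb : has_lbound D by exists 0 => _ [t _ <-]; rewrite addr_ge0 ?sqn_ge0.
have dD t : S t -> inf D <= sqn2 (p - t) by move=> St; apply: ge_inf => //; exists t.
have Dd e : 0 < e -> exists2 t, S t & sqn2 (p - t) < inf D + e.
  move=> e0; have [|_ [t St <-] ht] := @inf_adherent _ D e e0 _; last by exists t.
  by split.
pose E e := [set t | S t /\ sqn2 (p - t) < inf D + e].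
pose Phi := filter_from [set e : R | 0 < e] E.
have PhiF : ProperFilter Phi.
  apply: filter_from_proper; last by move=> e /= /Dd[t St ht]; exists t.
  apply: filter_from_filter; first by exists 1 => /=.
  move=> e1 e2 /= e10 e20; exists (Num.min e1 e2) => /=; first by rewrite lt_min e10.
  move=> t [St ht]; split; split => //; apply: lt_le_trans ht _;
  by rewrite lerD2l ge_min lexx ?orbT.
have PhiE e : 0 < e -> Phi (E e) by move=> e0; exists e.
pose half : R := 2^-1.
have half2 : half%:C + half%:C = 1 by rewrite -rmorphD /= /half -[2^-1]mul1r -splitr.
(* Parallelogram law around [p]. *)
have par s t : S s -> S t -> sqn2 (s - t) =
    2 * sqn2 (p - s) + 2 * sqn2 (p - t) - 4 * sqn2 (p - half%:C *: (s + t)).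
  move=> Ss St; rewrite /sqn2 /=.
  have h (x y z : H) : sqn (y - z) =
      2 * sqn (x - y) + 2 * sqn (x - z) - 4 * sqn (x - half%:C *: (y + z)).
    have -> : y - z = (x - z) - (x - y) by rewrite opprB [RHS]addrC addrA subrK.
    have -> : x - half%:C *: (y + z) = half%:C *: ((x - z) + (x - y)).
      rewrite addrACA -opprD scalerBr (addrC z); congr (_ - _).
      by rewrite scalerDr -scalerDl half2 scale1r.
    rewrite sqnZ /= (sqnB (x - z)) (sqnD (x - z)) expr0n addr0.
    by rewrite /half; field.
  by rewrite (h p.1 s.1) (h p.2 s.2); ring.
have mid s t : S s -> S t -> S (half%:C *: (s + t)).
  move=> Ss St; rewrite -[X in S X]addr0; apply: (SL) => //.
  by rewrite -[s]scale1r; apply: (SL).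
have close e s t : E e s -> E e t -> sqn2 (s - t) < 4 * e.
  move=> [Ss hs] [St ht]; rewrite (par s t)//.
  have := dD _ (mid _ _ Ss St); lra.
have [a ha] : exists a : H, fst @ Phi --> a.
  apply: hilbert_cauchy => e e0; exists (E (e / 4)); first by apply: PhiE; lra.
  move=> s t hs ht; have := close _ _ _ hs ht.
  rewrite /sqn2 /=; have := sqn_ge0 (s.2 - t.2); lra.
have [b hb] : exists b : H, snd @ Phi --> b.
  apply: hilbert_cauchy => e e0; exists (E (e / 4)); first by apply: PhiE; lra.
  move=> s t hs ht; have := close _ _ _ hs ht.
  rewrite /sqn2 /=; have := sqn_ge0 (s.1 - t.1); lra.
exists (a, b).
  have hab : (fun t : H * H => (t.1, t.2)) @ Phi --> (a, b) by apply: cvg_pair.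
  apply: (closed_cvg _ Scl _ _ hab).
  by apply: (filterS _ (PhiE 1 ltr01)) => -[? ?] [].
move=> t St; apply: le_trans (dD t St).
have lim : sqn2 (p - s) @[s --> Phi] --> sqn2 (p - (a, b)).
  apply: cvgD; apply: sqn_cvg; apply: cvgB => //; exact: cvg_cst.
apply/ler_addgt0Pr => e e0.
apply: (closed_cvg _ (@closed_le _ (inf D + e)) _ _ lim).
by apply: (filterS _ (PhiE e e0)) => s [_ /ltW].
Qed.

(** The adjoint of [S] is the orthogonal complement of [S] turned by
[(u, v) |-> (- v, u)]. If [s] is the projection of [p] on [S], then turning
[q := p - s] gives an element of the adjoint; testing [p] against it says that [q]
is orthogonal to [p], and [q] is orthogonal to [s] as well, hence to itself. *)
Lemma biadjoint_closed S : linear_subspace S -> closed S ->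
  adjoint (adjoint S) `<=` S.
Proof.
move=> SL Scl p pSS; have [s Ss hs] := closed_projection p SL Scl.
case: (SL) => S0 SL'.
set q := p - s.
have orth t : S t -> dot q.1 t.1 + dot q.2 t.2 = 0.
  move=> St; set w := dot q.1 t.1 + dot q.2 t.2.
  (* Minimality of [s] against the competitor [s + r w t]; below
     [r := (sqn2 t + 1)^-1] makes the quadratic term lose to the linear one. *)
  have ineq (r : R) : 2 * r * (complex.Re w ^+ 2 + complex.Im w ^+ 2) <=
      r ^+ 2 * (complex.Re w ^+ 2 + complex.Im w ^+ 2) * sqn2 t.
    have := hs _ (SL' (r%:C * w) _ _ St Ss).
    rewrite opprD [- _ - _]addrC addrA -/q /sqn2 /= !sqnB !sqnZ !dotZr.
    have : w = dot q.1 t.1 + dot q.2 t.2 by [].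
    move: w (dot q.1 t.1) (dot q.2 t.2) => -[a b] [a1 b1] [a2 b2] /=.
    by move=> [-> ->] /=; lra.
  have t0 : 0 <= sqn2 t by rewrite addr_ge0 ?sqn_ge0.
  have := ineq (sqn2 t + 1)^-1.
  set W := complex.Re w ^+ 2 + complex.Im w ^+ 2; set r := _^-1 => hr.
  have r0 : 0 < r by rewrite invr_gt0 ltr_wpDl.
  have rt : r * (sqn2 t + 1) = 1 by rewrite mulVf// gt_eqF// ltr_wpDl.
  have W0 : W <= 0.
    have : r * W * (2 - r * sqn2 t) <= 0 by lra.
    have : 0 < 2 - r * sqn2 t by lra.
    by move=> h; rewrite pmulr_lle0// pmulr_rle0.
  apply: complex_eqP => /=; apply/eqP; rewrite -sqrf_eq0 eq_le sqr_ge0 andbT;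
  apply: le_trans W0; by rewrite (lerDl, lerDr) sqr_ge0.
have qS : adjoint S (- q.2, q.1).
  move=> t St /=; apply/eqP; rewrite dotNl -subr_eq0 opprK.
  exact/eqP/orth.
have hp := pSS _ qS; rewrite /= dotNr in hp.
have hq := orth _ Ss.
have q0 : sqn2 q = 0.
  have -> : sqn2 q = complex.Re (dot p.1 q.1 + dot p.2 q.2
      - Num.conj (dot q.1 s.1 + dot q.2 s.2)).
    rewrite rmorphD /= -!dotC /sqn2 /sqn.
    rewrite -raddfD /=; congr complex.Re; rewrite /q /= !dotDl !dotNl; ring.
  by rewrite -hp hq rmorph0 subr0 addNr.
have : sqn q.1 = 0 /\ sqn q.2 = 0.
  by move: q0; rewrite /sqn2; have := sqn_ge0 q.1; have := sqn_ge0 q.2; lra.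
move=> [/eqP + /eqP +]; rewrite !sqn_eq0 !subr_eq0 => /eqP h1 /eqP h2.
by rewrite [p]surjective_pairing h1 h2 -surjective_pairing.
Qed.

Lemma adjoint_closure S p : (forall q, S q -> dot p.2 q.1 = dot p.1 q.2) ->
  forall q, closure S q -> dot p.2 q.1 = dot p.1 q.2.
Proof.
move=> h q; rewrite closureEcvg => -[G GP [Gq SG]].
have [c1 c2] : (fst @ G --> q.1) /\ (snd @ G --> q.2).
  by case: q Gq => q1 q2 Gq; split=> A hA; apply: Gq; [exact: (cvg_fst hA)|exact: (cvg_snd hA)].
have l1 : dot p.2 u.1 @[u --> G] --> dot p.2 q.1 by exact: dot_cvgr c1.
have l2 : dot p.1 u.2 @[u --> G] --> dot p.1 q.2 by exact: dot_cvgr c2.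
apply: (cvg_unique _ l1 (cvg_trans _ l2)); first exact: norm_hausdorff.
apply: near_eq_cvg; apply: SG => u Su /=; exact/esym/h.
Qed.

End biadjoint.

(** * Maximality of boundary relations *)
Section green_form.
Variables (R : realType) (H B : hilbertType R).
Local Notation C := R[i].
Implicit Types (k : (H * H) * (B * B)) (G : set ((H * H) * (B * B))).

(** The indefinite form for which (BR2) says that [G] is a neutral subspace. *)
Definition green k k' : C :=
  (dot k.1.2 k'.1.1 - dot k.1.1 k'.1.2) - (dot k.2.2 k'.2.1 - dot k.2.1 k'.2.2).

Lemma greenC k k' : green k' k = - Num.conj (green k k').
Proof. rewrite /green !rmorphB /= -!dotC; ring. Qed.

Lemma greenPl a k1 k2 k : green (a *: k1 + k2) k = a * green k1 k + green k2 k.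
Proof. rewrite /green /= !dotDl !dotZl; ring. Qed.

Lemma greenPr a k1 k2 k :
  green k (a *: k1 + k2) = Num.conj a * green k k1 + green k k2.
Proof. rewrite /green /= !dotDr !dotZr; ring. Qed.

Lemma BR2_green G : BR2 G <-> forall k k', G k -> G k' -> green k k' = 0.
Proof.
split=> [h [[f g] [a b]] [[f' g'] [a' b']] Gk Gk'|h f g f' g' a b a' b' Gk Gk'].
  by rewrite /green /= (h _ _ _ _ _ _ _ _ Gk Gk') subrr.
by have /eqP := h _ _ Gk Gk'; rewrite /green /= subr_eq0 => /eqP.
Qed.

Lemma adjoint_linear (T : set (H * H)) : linear_subspace (adjoint T).
Proof.
split=> [q _|a u v hu hv q Tq] /=; first by rewrite !dot0l.
by rewrite !dotDl !dotZl hu// hv.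
Qed.

End green_form.

Section maximality.
Variables (R : realType) (H B : hilbertType R).
Local Notation C := R[i].
Variables (S : set (H * H)) (G : set ((H * H) * (B * B))).
Hypotheses (hS : closed_symmetric S) (hG : boundary_relation S G).
Implicit Types (k : (H * H) * (B * B)).

Lemma br_linear a k k' : G k -> G k' -> G (a *: k + k').
Proof. by case: hG => -[_ +] _ _ _; exact. Qed.

Lemma br0 : G 0.
Proof. by case: hG => -[]. Qed.

Lemma br_green k k' : G k -> G k' -> green k k' = 0.
Proof. by case: hG => _ _ /BR2_green + _; exact. Qed.

(** Adjoining the line spanned by [k] preserves (BR1) and (BR2), so (BR3)
forces [k] to be in [G] already. *)
Lemma maximal_in_adjoint k : adjoint S k.1 ->
  (forall k', G k' -> green k k' = 0) -> green k k = 0 -> G k.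
Proof.
move=> Sk hk kk; case: (hG) => -[G0 GL] [dG cG] _ maxG.
have hk' k' : G k' -> green k' k = 0.
  by move=> /hk h; rewrite greenC h rmorph0 oppr0.
pose G' := [set k' | exists c u, G u /\ k' = c *: k + u].
have GG' : G `<=` G' by move=> u Gu; exists 0, u; rewrite scale0r add0r.
rewrite -(maxG G') //; first by exists 1, 0; rewrite scale1r addr0.
- split; first by apply: GG'.
  move=> a _ _ [c [u [Gu ->]]] [d [v [Gv ->]]].
  exists (a * c + d), (a *: u + v); split; first exact: GL.
  by rewrite scalerDr scalerDl scalerA addrACA.
- split.
    move=> p [q [c [u [Gu pq]]]].
    have -> : p = c *: k.1 + u.1 by rewrite -[p]/(p, q).1 pq.
    apply: (adjoint_linear S).2 => //; apply: dG; exists u.2.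
    by rewrite -surjective_pairing.
  apply: subset_trans cG _; apply: closureS => p [q Gpq].
  by exists q; apply: GG'.
- apply/BR2_green => _ _ [c [u [Gu ->]]] [d [v [Gv ->]]].
  rewrite greenPl !greenPr kk hk// hk'// br_green//; ring.
Qed.

Lemma relation_sub_ker p : S p -> G (p, 0).
Proof.
move=> Sp; case: (hG) => _ [dG _] _ _; case: (hS) => _ _ SS.
apply: maximal_in_adjoint => [|k' Gk'|]; first exact: SS.
  have /dG/(_ _ Sp) e : relation_dom G k'.1 by exists k'.2; rewrite -surjective_pairing.
  have : Num.conj (dot k'.1.2 p.1) = Num.conj (dot k'.1.1 p.2) by rewrite e.
  by rewrite -!dotC /green /= !dot0l => ->; rewrite !subrr.
by rewrite /green /= !dot0l (SS _ Sp)// !subrr.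
Qed.

(** [S] sits in the kernel of [G], and being Green-orthogonal to [S x {0}] means
exactly that [k.1] is in the adjoint of [S]. *)
Lemma maximal k :
  (forall k', G k' -> green k k' = 0) -> green k k = 0 -> G k.
Proof.
move=> hk kk; apply: maximal_in_adjoint => // q Sq.
have := hk _ (relation_sub_ker Sq).
by rewrite /green /= !dot0r subrr subr0 => /eqP; rewrite subr_eq0 => /eqP.
Qed.

(** By Green's identity [p] is in the adjoint of the domain of [G], hence, by
density, in the second adjoint of [S]. *)
Lemma ker_sub_relation p : G (p, 0) -> S p.
Proof.
case: (hS) => SL Scl _; case: (hG) => _ [_ cG] _ _ Gp.
apply: biadjoint_closed => // q /cG; apply: adjoint_closure => {}q [b Gb].
have := br_green Gp Gb.
by rewrite /green /= !dot0l subrr subr0 => /eqP; rewrite subr_eq0 => /eqP.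
Qed.

(** Closedness of [G]: Green's identity passes to the limit first against the
elements of [G] and then, since the approximants are in [G], against the limit
itself; maximality concludes. *)
Lemma br_cvg T (Phi : set_system T) {FF : ProperFilter Phi} (f g : T -> H)
    (a b : T -> B) f0 g0 a0 b0 :
  (\forall t \near Phi, G ((f t, g t), (a t, b t))) ->
  f @ Phi --> f0 -> g @ Phi --> g0 -> a @ Phi --> a0 -> b @ Phi --> b0 ->
  G ((f0, g0), (a0, b0)).
Proof.
move=> Gt cf cg ca cb.
have lim k' : green ((f t, g t), (a t, b t)) k' @[t --> Phi] -->
    green ((f0, g0), (a0, b0)) k'.
  by apply: cvgB; apply: cvgB; exact: dot_cvgl.
have nul k' : (\forall t \near Phi, green ((f t, g t), (a t, b t)) k' = 0) ->
    green ((f0, g0), (a0, b0)) k' = 0.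
  move=> h; apply: (cvg_unique _ (lim k')); first exact: norm_hausdorff.
  apply: (@cvg_trans _ (cst (0 : C) @ Phi)); last exact: cvg_cst.
  apply: near_eq_cvg.
  by apply: filterS h => t /= ->.
have hk k' : G k' -> green ((f0, g0), (a0, b0)) k' = 0.
  by move=> Gk'; apply: nul; apply: filterS Gt => t Gt; exact: br_green.
apply: maximal => //; apply: nul; apply: filterS Gt => t Gt.
by rewrite greenC hk// rmorph0 oppr0.
Qed.

End maximality.

(** * Simple relations have no real eigenvectors *)
Section simplicity.
Variables (R : realType) (H : hilbertType R).
Local Notation C := R[i].
Variable (S : set (H * H)).

(** An eigenvector [f] for a real [x] would split off from [S] the selfadjoint
relation spanned by [(f, x f)]: as [S] is symmetric, subtracting from [p] the
multiple of [(f, x f)] that makes the first component orthogonal to [f] does the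
same for the second one. *)
Lemma simple_no_real_eigenvector (x : R) (f : H) :
  closed_symmetric S -> simple_relation S -> S (f, x%:C *: f) -> f = 0.
Proof.
move=> [SL Scl SS] hsimple Sf; apply: contrapT => /eqP f0.
have nf0 : dot f f != 0 by rewrite dnorm_eq0.
have xc : Num.conj x%:C = x%:C :> C by rewrite conjC_real.
pose E1 := [set h : H | dot h f = 0].
pose E2 := [set h : H | exists c : C, h = c *: f].
pose S1 := [set p : H * H | [/\ S p, E1 p.1 & E1 p.2]].
pose S2 := [set p : H * H | exists c : C, p = c *: (f, x%:C *: f)].
have proj h : dot (h - (dot h f / dot f f) *: f) f = 0.
  by rewrite dotDl dotNl dotZl divfK// subrr.
have adjf p : S p -> dot p.2 f = x%:C * dot p.1 f.
  by move=> Sp; have := SS _ Sp _ Sf; rewrite /= dotZr xc.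
have E1L : linear_subspace E1.
  by split=> [|a u v hu hv]; rewrite /E1 /= ?dot0l// dotDl dotZl hu hv mulr0 addr0.
have L2 (V : lmodType C) (v : V) : linear_subspace [set u | exists c : C, u = c *: v].
  split=> [|a _ _ [c ->] [d ->]]; first by exists 0; rewrite scale0r.
  by exists (a * c + d); rewrite scalerDl scalerA.
apply: hsimple; exists E1, E2, S1, S2; split.
- split=> [//||h _ hh [c ->]|h]; [exact: L2|by rewrite dotZr hh mulr0|].
  exists (h - (dot h f / dot f f) *: f), ((dot h f / dot f f) *: f).
  by split; [exact: proj|exists (dot h f / dot f f)|rewrite subrK].
- split; last by move=> p [].
  case: SL => S0 SL; split; first by split=> //; exact: E1L.1.
  by move=> a u v [? ? ?] [? ? ?]; split; [exact: SL|exact: E1L.2|exact: E1L.2].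
- split; first split; first exact: L2.
    by move=> _ [c ->] /=; split; [exists c|exists (c * x%:C); rewrite scalerA].
  apply/seteqP; split=> [_ [c ->]|[u v] /= [[a ->] [b ->] h]].
    split=> /=; [by exists c|by exists (c * x%:C); rewrite scalerA|].
    move=> _ [d ->] /=; rewrite !(dotZl, dotZr) xc; ring.
  have S2f : S2 (f, x%:C *: f) by exists 1; rewrite scale1r.
  have /= := h _ S2f.
  rewrite !(dotZl, dotZr) xc mulrA => /(mulIf nf0) ->.
  by rewrite -scalerA; exists a.
- apply/seteqP; split=> [p Sp|_ [p1 [_ [[Sp1 _ _] [c ->] ->]]]]; last first.
    by rewrite addrC; apply: SL.2.
  pose c := dot p.1 f / dot f f.
  have cE : dot p.2 f / dot f f = c * x%:C by rewrite adjf// /c; ring.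
  exists (p - c *: (f, x%:C *: f)), (c *: (f, x%:C *: f)).
  split; [|by exists c|by rewrite subrK].
  split; rewrite /E1 /=; [|exact: proj|by rewrite scalerA -cE proj].
  by rewrite addrC -scaleNr; apply: SL.2.
- move=> E20; have : E2 f by exists 1; rewrite scale1r.
  by rewrite E20 => /= fe; rewrite fe eqxx in f0.
Qed.

End simplicity.

(** * One-sided limits at zero *)
Section right_limits.
Variables (R : realType) (H : hilbertType R).
Local Notation C := R[i].

Lemma near0W (P : R -> Prop) :
  (forall e, 0 < e -> P e) -> \forall e \near (0 : R)^'+, P e.
Proof. by move=> h; near=> e; apply: h; near: e; exact: nbhs_right_gt.
Unshelve. all: by end_near. Qed.

Lemma near0_eq (V : topologicalType) (F F' : R -> V) (l : V) :
  (forall e, 0 < e -> F e = F' e) ->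
  F e @[e --> 0^'+] --> l -> F' e @[e --> 0^'+] --> l.
Proof.
move=> FF'; apply: cvg_trans; apply: near_eq_cvg.
by apply: near0W => e e0 /=; rewrite FF'.
Qed.

Lemma cvg_id0 : (e : R) @[e --> 0^'+] --> (0 : R).
Proof. exact: cvg_at_right_filter. Qed.

Lemma real_complex_cvg T (Phi : set_system T) {FF : Filter Phi} (F : T -> R) (l : R) :
  F @ Phi --> l -> (F t)%:C @[t --> Phi] --> l%:C.
Proof. by move=> Fl; apply/complex_cvgP; split => //=; exact: cvg_cst. Qed.

Lemma cauchy_of_sqn_le (F : R -> H) (phi : R -> R) (l : R) :
  (forall e d, 0 < e -> 0 < d -> sqn (F e - F d) <= `|phi e - phi d|) ->
  phi e @[e --> 0^'+] --> l -> exists f : H, F e @[e --> 0^'+] --> f.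
Proof.
move=> Fphi phil; apply: hilbert_cauchy => e e0.
have e2 : 0 < e / 2 by rewrite divr_gt0.
move/cvgrPdist_lt : phil => /(_ _ e2) hl.
exists [set t | 0 < t /\ `|l - phi t| < e / 2].
  by apply: filterI => //; exact: near0W.
move=> s t [s0 hs] [t0 ht]; apply: le_lt_trans (Fphi _ _ s0 t0) _.
have -> : phi s - phi t = (l - phi t) - (l - phi s) by ring.
by rewrite (splitr e); apply: le_lt_trans (ler_normB _ _) _; rewrite ltrD.
Qed.

Lemma nondecreasing_cvg0 (phi : R -> R) (c : R) :
  (forall e d, 0 < e -> e <= d -> phi e <= phi d) ->
  (forall e, 0 < e -> c <= phi e) ->
  exists2 l : R, c <= l & phi e @[e --> 0^'+] --> l.
Proof.
move=> inc cphi.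
have cv : cvg (phi e @[e --> 0^'+]).
  apply: nondecreasing_at_right_is_cvgr; near=> e.
    by move=> s t; rewrite !in_itv /= => /andP[s0 _] _; exact: inc.
  by exists c => _ [t /= + <-]; rewrite in_itv/= => /andP[t0 _]; exact: cphi.
have hl : phi e @[e --> 0^'+] --> lim (phi e @[e --> 0^'+]) by [].
exists (lim (phi e @[e --> 0^'+])) => //.
apply: (closed_cvg _ (@closed_ge _ c) _ _ hl).
exact: near0W.
Unshelve. all: by end_near. Qed.

Lemma nonincreasing_cvg0 (phi : R -> R) (c : R) :
  (forall e d, 0 < e -> e <= d -> phi d <= phi e) ->
  (forall e, 0 < e -> phi e <= c) ->
  exists l : R, phi e @[e --> 0^'+] --> l.
Proof.
move=> dec cphi.
have [|e e0|l _ hl] := @nondecreasing_cvg0 (\- phi) (- c).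
- by move=> e d e0 ed /=; rewrite lerN2; exact: dec.
- by rewrite lerN2; exact: cphi.
by exists (- l); rewrite -[phi]opprK; exact: cvgN.
Qed.

End right_limits.

(** * Defect elements on the vertical line above a real point *)
Section weyl.
Variables (R : realType) (H : hilbertType R).
Local Notation C := R[i].
Variables (S : set (H * H)) (G : set ((H * H) * (C * C))) (m : C -> C).
Hypotheses (hS : closed_symmetric S) (hsimple : simple_relation S).
Hypotheses (hG : boundary_relation S G) (hm : weyl_function G m).
Variable x : R.

(** On the real axis the terms of Green's identity in [H] cancel, so the
boundary values of the eigenvectors at [x] span at most a real line. *)
Lemma real_kernel_boundary f a b f' a' b' :
  G ((f, x%:C *: f), (a, b)) -> G ((f', x%:C *: f'), (a', b')) ->
  b * Num.conj a' = a * Num.conj b'.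
Proof.
move=> Gf Gf'; have := br_green hG Gf Gf'.
rewrite /green /= dotZl dotZr conjC_real subrr sub0r => /eqP.
by rewrite oppr_eq0 subr_eq0 !dot_C => /eqP.
Qed.

(** A difference of two candidates is an eigenvector of [S] at [x], which
simplicity excludes. *)
Lemma real_kernel_inj f f' a b :
  G ((f, x%:C *: f), (a, b)) -> G ((f', x%:C *: f'), (a, b)) -> f = f'.
Proof.
move=> Gf Gf'; apply/eqP; rewrite -subr_eq0; apply/eqP.
apply: (simple_no_real_eigenvector (x := x) hS hsimple).
apply: (ker_sub_relation hS hG).
have := br_linear hG (-1) Gf' Gf; congr G.
congr pair; congr pair => /=.
- by rewrite scaleN1r addrC.
- by rewrite scaleN1r addrC scalerBr.
- by rewrite scaleN1r addNr.
- by rewrite scaleN1r addNr.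
Qed.

Lemma real_kernel0 f : G ((f, x%:C *: f), (0, 0)) -> f = 0.
Proof.
move=> Gf; apply: (real_kernel_inj Gf (a := 0) (b := 0)).
by rewrite scaler0; exact: (br0 hG).
Qed.

Local Notation z e := (x +i* e).

Lemma weyl_solutions :
  exists F : R -> H, forall e, 0 < e -> G ((F e, z e *: F e), (1, m (z e))).
Proof.
have sol e : exists f, 0 < e -> G ((f, z e *: f), (1, m (z e))).
  case: (ltP 0 e) => [e0|]; last by exists 0.
  have : weyl_family G (z e) (1, m (z e)) by rewrite hm /= ?gt_eqF// mulr1.
  by case=> f Gf; exists f.
by have [F GF] := choice sol; exists F.
Qed.

Section solutions.
Variable F : R -> H.
Hypothesis GF : forall e, 0 < e -> G ((F e, z e *: F e), (1, m (z e))).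

(** The Gram matrix of the family [F] in terms of [m], by Green's identity; the
three metric identities that follow are read off from it. *)
Lemma dot_weyl e d : 0 < e -> 0 < d ->
  'i%C * (e + d)%:C * dot (F e) (F d) = m (z e) - Num.conj (m (z d)).
Proof.
move=> e0 d0; have := br_green hG (GF e0) (GF d0).
rewrite /green /= dotZl dotZr !dot_C rmorph1 mulr1 mul1r -mulrBl => /eqP.
rewrite subr_eq0 => /eqP <-; congr (_ * _).
by apply: complex_eqP => /=; ring.
Qed.

Lemma Re_dot_weyl e d : 0 < e -> 0 < d ->
  (e + d) * complex.Re (dot (F e) (F d)) =
  complex.Im (m (z e)) + complex.Im (m (z d)).
Proof.
move=> e0 d0; have := congr1 (@complex.Im R) (dot_weyl e0 d0).
by rewrite raddfB /= Im_conjC opprK !ImM !ReM /= => <-; ring.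
Qed.

Lemma sqn_weyl e : 0 < e -> e * sqn (F e) = complex.Im (m (z e)).
Proof. by move=> e0; have := Re_dot_weyl e0 e0; rewrite -/(sqn _); lra. Qed.

(** Consequences of [dot_weyl]: the two natural normalisations of the defect
elements, [F e] here and [e F e] in the next lemma, both satisfy the relation
required of a monotone family in [monotone_family] and [monotone_family_cvg]. *)
Lemma sqn_weylB e d : 0 < e -> 0 < d ->
  (e + d) * sqn (F e - F d) = (sqn (F d) - sqn (F e)) * (e - d).
Proof.
move=> e0 d0; have := Re_dot_weyl e0 d0; rewrite -!sqn_weyl// sqnB.
set D := complex.Re _; set u := sqn (F e); set v := sqn (F d) => h.
have -> : (e + d) * (u + v - 2 * D) = (e + d) * (u + v) - 2 * ((e + d) * D) by ring.
rewrite h; ring.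
Qed.

Lemma sqn_scaled_weylB e d : 0 < e -> 0 < d ->
  (e + d) * sqn (e%:C *: F e - d%:C *: F d) =
  (e ^+ 2 * sqn (F e) - d ^+ 2 * sqn (F d)) * (e - d).
Proof.
move=> e0 d0; have := Re_dot_weyl e0 d0; rewrite -!sqn_weyl// sqnB !sqnZ.
rewrite dotZl dotZr conjC_real !ReM !ImM /=.
set D := complex.Re _; set u := sqn (F e); set v := sqn (F d) => h.
set D' := complex.Im _.
transitivity ((e + d) * (e ^+ 2 * u + d ^+ 2 * v) - 2 * e * d * ((e + d) * D)); first by ring.
rewrite h; ring.
Qed.

End solutions.
End weyl.

(** * Convergence of monotone families *)
(** If [sqn (F e - F d) = (phi e - phi d) (e - d) / (e + d)], then positivity of
the left side makes [phi] monotone, and [`|e - d| <= e + d] makes [F] Cauchy as soon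
as [phi] converges. *)
Section monotone_families.
Variables (R : realType) (H : hilbertType R).
Variables (F : R -> H) (phi : R -> R).
Hypothesis Fphi : forall e d, 0 < e -> 0 < d ->
  (e + d) * sqn (F e - F d) = (phi e - phi d) * (e - d).

Lemma monotone_family e d : 0 < e -> e <= d -> phi e <= phi d.
Proof.
move=> e0; rewrite le_eqVlt => /predU1P[->//|ed].
have d0 := lt_trans e0 ed; have := Fphi e0 d0.
have : 0 <= (e + d) * sqn (F e - F d) by rewrite mulr_ge0 ?sqn_ge0// addr_ge0// ltW.
by move=> /[swap] -> ; rewrite nmulr_lge0 ?subr_lt0// subr_le0.
Qed.

Lemma monotone_family_cvg (l : R) :
  phi e @[e --> 0^'+] --> l -> exists f : H, F e @[e --> 0^'+] --> f.
Proof.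
apply: cauchy_of_sqn_le => e d e0 d0.
rewrite -(@ler_pM2l _ (e + d)) ?addr_gt0// Fphi//.
apply: le_trans (ler_norm _) _; rewrite normrM mulrC ler_wpM2r//.
by apply: le_trans (ler_normB _ _) _; rewrite !gtr0_norm.
Qed.

End monotone_families.

(** * Boundary limits of the Weyl function and real eigenvectors *)
Section weyl_limits.
Variables (R : realType) (H : hilbertType R).
Local Notation C := R[i].
Variables (S : set (H * H)) (G : set ((H * H) * (C * C))) (m : C -> C).
Hypotheses (hS : closed_symmetric S) (hsimple : simple_relation S).
Hypotheses (hG : boundary_relation S G) (hm : weyl_function G m).
Variable x : R.
Local Notation z e := (x +i* e).

Lemma eC_cvg : e%:C @[e --> 0^'+] --> (0 : C).
Proof. by apply/complex_cvgP; split => /=; [exact: cvg_id0|exact: cvg_cst]. Qed.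

Lemma z_cvg : z e @[e --> 0^'+] --> x%:C.
Proof. by apply/complex_cvgP; split => /=; [exact: cvg_cst|exact: cvg_id0]. Qed.

(** An eigenvector at [x] with boundary value [(1, b)] is the limit of the defect
elements [F e]. Its existence is the same as boundedness of
[sqn (F e) = Im m / e]: given [f], Green's identity identifies the difference quotient of [m] with
[dot (F e) f], and Cauchy-Schwarz gives [sqn (F e) <= sqn f]; given the limits of
[m], the real part of the difference quotient is [sqn (F e)]. In both directions
[F] converges as a monotone family and [G] is closed. *)
Lemma real_kernel_value (b : R) :
  (exists f, G ((f, x%:C *: f), (1, b%:C))) <->
  (m (z e) @[e --> 0^'+] --> b%:C) /\
  (exists2 d : R, 0 <= d &
     (m (z e) - b%:C) / ('i%C * e%:C) @[e --> 0^'+] --> d%:C).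
Proof.
have [F GF] := weyl_solutions hm x.
have nearG : \forall e \near (0 : R)^'+, G ((F e, z e *: F e), (1, m (z e))).
  exact: near0W.
have mono e d : 0 < e -> 0 < d -> (e + d) * sqn (F e - F d) =
    (- sqn (F e) - - sqn (F d)) * (e - d).
  by move=> e0 d0; rewrite (sqn_weylB hG GF)// opprK addrC.
have ie0 e : 0 < e -> 'i%C * e%:C != 0 :> C.
  move=> e0; rewrite mulf_neq0//; first by rewrite eq_complex /= oner_eq0 andbF.
  by rewrite eq_complex /= gt_eqF.
split=> [[f Gf]|[mb [d d0 qd]]].
- have dotFf e : 0 < e -> m (z e) - b%:C = 'i%C * e%:C * dot (F e) f.
    move=> e0; have := br_green hG (GF _ e0) Gf.
    rewrite /green /= dotZl dotZr !dot_C !conjC_real rmorph1 mulr1 mul1r.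
    rewrite -mulrBl => /eqP; rewrite subr_eq0 => /eqP <-.
    by congr (_ * _); apply: complex_eqP => /=; ring.
  have ReF e : 0 < e -> sqn (F e) = complex.Re (dot (F e) f).
    move=> e0; have := congr1 (@complex.Im R) (dotFf _ e0).
    rewrite raddfB /= subr0 -(sqn_weyl hG GF)// !ImM !ReM /=.
    by move=> h; apply: (@mulfI _ e); [rewrite gt_eqF|rewrite h; ring].
  have bound e : 0 < e -> sqn (F e) <= sqn f.
    move=> e0; have := cauchy_schwarz (F e) f; rewrite -ReF//.
    have := sqn_ge0 (F e); have := sqn_ge0 f; have := sqr_ge0 (complex.Im (dot (F e) f)).
    set u := sqn (F e); set v := sqn f; set w := _ ^+ 2 => w0 v0 u0.
    by case: (ltrgt0P u) u0 => // [u0 _ h|-> //]; rewrite -(ler_pM2l u0); lra.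
  have dec e d : 0 < e -> e <= d -> sqn (F d) <= sqn (F e).
    by move=> e0 ed; rewrite -lerN2; exact: (monotone_family mono).
  have [l /cvgN hl] := nonincreasing_cvg0 dec bound.
  have [f0 Ff0] := monotone_family_cvg mono hl.
  have dotl : dot (F e) f @[e --> 0^'+] --> dot f0 f by exact: dot_cvgl.
  have mb : m (z e) @[e --> 0^'+] --> b%:C.
    apply: (near0_eq (F := fun e => b%:C + 'i%C * e%:C * dot (F e) f)).
      by move=> e e0; rewrite -dotFf// addrC subrK.
    rewrite -[X in _ --> X]addr0; apply: cvgD; first exact: cvg_cst.
    rewrite -(mul0r (dot f0 f)); apply: cvgM; last exact: dotl.
    rewrite -(mulr0 'i%C); apply: cvgM; first exact: cvg_cst.
    exact: eC_cvg.
  have Gf0 : G ((f0, x%:C *: f0), (1, b%:C)).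
    apply: (br_cvg hS hG (a := fun=> 1) nearG Ff0 (cvgZ z_cvg Ff0) (cvg_cst _) mb).
  split=> //; exists (sqn f); first exact: sqn_ge0.
  apply: (near0_eq (F := fun e => dot (F e) f)).
    by move=> e e0; rewrite dotFf// mulrAC divff ?mul1r ?ie0.
  have ff0 : f0 = f := real_kernel_inj hS hsimple hG Gf0 Gf.
  by rewrite ff0 dot_sqn in dotl.
- have sqnF e : 0 < e -> complex.Re ((m (z e) - b%:C) / ('i%C * e%:C)) = sqn (F e).
    move=> e0; have : m (z e) - b%:C = (m (z e) - b%:C) / ('i%C * e%:C) * ('i%C * e%:C).
      by rewrite divfK// ie0.
    set q := _ / _ => /(congr1 (@complex.Im R)).
    rewrite raddfB /= subr0 -(sqn_weyl hG GF)// !ImM !ReM /=.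
    by move=> h; apply: (@mulfI _ e); [rewrite gt_eqF|rewrite h; ring].
  have /complex_cvgP[/= ud _] := qd.
  have {}ud : - sqn (F e) @[e --> 0^'+] --> - d.
    by apply: cvgN; apply: near0_eq sqnF ud.
  have [f Ff] := monotone_family_cvg mono ud.
  exists f; apply: (br_cvg hS hG (a := fun=> 1) nearG Ff (cvgZ z_cvg Ff) (cvg_cst _) mb).
Qed.

(** The same argument for [g e := e F e], whose squared norm is [e Im m] and whose
first boundary value [e] tends to zero. The quantity [e Im m] always decreases to
a limit; an eigenvector [f] keeps it away from zero, and when the limit is
positive, [g] converges to an eigenvector. *)
Lemma pole_point_spectrum :
  point_spectrum (ker_pi1 G) x%:C <->
  exists2 v : R, 0 < v & e * complex.Im (m (z e)) @[e --> 0^'+] --> v.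
Proof.
have [F GF] := weyl_solutions hm x.
pose p e := e ^+ 2 * sqn (F e).
have pE e : 0 < e -> p e = e * complex.Im (m (z e)).
  by move=> e0; rewrite -(sqn_weyl hG GF)// mulrA.
pose g e := e%:C *: F e.
have sqng e : sqn (g e) = p e by rewrite sqnZ /= expr0n addr0.
have mono e d : 0 < e -> 0 < d -> (e + d) * sqn (g e - g d) = (p e - p d) * (e - d).
  exact: (sqn_scaled_weylB hG GF).
split=> [/eqP|[v v0 pv]].
- move=> h.
  have [f [b Gf] f0] : exists2 f, (exists b, G ((f, x%:C *: f), (0, b))) & f != 0.
    apply: contrapT => hn; move/eqP: h; apply; apply/seteqP; split=> f /=.
      move=> [b Gb]; apply: contrapT => /eqP f0; apply: hn; exists f => //.
      by exists b.
    by move=> ->; exists 0; rewrite scaler0; exact: (br0 hG).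
  have b0 : b != 0.
    apply: contra_neq f0 => b0; rewrite b0 in Gf.
    exact: (real_kernel0 hS hsimple hG Gf).
  pose c := (complex.Re b ^+ 2 + complex.Im b ^+ 2) / sqn f.
  have c0 : 0 < c.
    rewrite divr_gt0 ?sqn_gt0// lt0r addr_ge0 ?sqr_ge0// andbT.
    apply: contra_neq b0 => /eqP; rewrite paddr_eq0 ?sqr_ge0// !sqrf_eq0.
    by move=> /andP[/eqP ? /eqP ?]; apply: complex_eqP.
  have cp e : 0 < e -> c <= p e.
    move=> e0; have := br_green hG (GF _ e0) Gf.
    rewrite /green /= dotZl dotZr !dot_C conjC_real rmorph0 mulr0 mul1r sub0r opprK.
    rewrite -mulrBl => /eqP; rewrite addr_eq0 => /eqP hb.
    rewrite /c ler_pdivrMr ?sqn_gt0// /p -mulrA.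
    apply: le_trans (ler_wpM2l (sqr_ge0 e) (cauchy_schwarz _ _)).
    have hr := congr1 (@complex.Re R) hb; have hi := congr1 (@complex.Im R) hb.
    move: hr hi; rewrite ReM ImM !raddfN /= Re_conjC Im_conjC => hr hi.
    have -> : complex.Re b = e * complex.Im (dot (F e) f) by lra.
    have -> : complex.Im b = e * complex.Re (dot (F e) f) by lra.
    by rewrite !exprMn -mulrDr addrC.
  have [l cl pl] := nondecreasing_cvg0 (monotone_family mono) cp.
  exists l; first exact: lt_le_trans cl.
  exact: near0_eq pE pl.
- have {}pv : p e @[e --> 0^'+] --> v.
    by apply: near0_eq pv => e e0; rewrite pE.
  have [f gf] := monotone_family_cvg mono pv.
  have f0 : f != 0.
    have h : p e @[e --> 0^'+] --> sqn f.
      by rewrite -(funext sqng : (fun e => sqn (g e)) = p); exact: sqn_cvg.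
    rewrite -sqn_gt0; suff -> : sqn f = v by [].
    by apply: (cvg_unique _ h); first exact: norm_hausdorff.
  have [b mb] : exists b : C, e%:C * m (z e) @[e --> 0^'+] --> b.
    (* Only the imaginary part of [e m] is known to converge. Pairing [g e] with
       the fixed defect element [F 1] controls [e m] itself. *)
    exists (('i%C * (0 + 1)%:C) * dot f (F 1) + 0 * Num.conj (m (z 1))).
    apply: (near0_eq (F := fun e => ('i%C * (e + 1)%:C) * dot (g e) (F 1)
       + e%:C * Num.conj (m (z 1)))).
      move=> e e0; rewrite /g dotZl mulrCA (dot_weyl hG GF)//; ring.
    apply: cvgD; last by apply: cvgM; [exact: eC_cvg|exact: cvg_cst].
    apply: cvgM; last exact: dot_cvgl.
    apply: cvgM; first exact: cvg_cst.
    apply: real_complex_cvg; apply: cvgD; [exact: cvg_id0|exact: cvg_cst].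
  have Gf : G ((f, x%:C *: f), (0, b)).
    suff nearG : \forall e \near (0 : R)^'+,
        G ((g e, z e *: g e), (e%:C, e%:C * m (z e))).
      exact: (br_cvg hS hG nearG gf (cvgZ z_cvg gf) eC_cvg mb).
    apply: near0W => e e0; have := br_linear hG e%:C (GF _ e0) (br0 hG).
    rewrite addr0; congr G; congr pair; congr pair => //=.
    + by rewrite /g !scalerA mulrC.
    + exact: mulr1.
  move=> h; have : kernel_sub (ker_pi1 G) x%:C f by exists b.
  by rewrite h => /= fe; rewrite fe eqxx in f0.
Qed.

End weyl_limits.

(** * The eigenspace of the pasted relation *)
Section dimension.
Variables (K : fieldType) (V : lmodType K).

Lemma has_dim_gt0_neq0 (E : set V) (d : nat) :
  has_dim E d -> (0 < d)%N -> E <> [set 0].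
Proof.
case: d => // d [e [free ->]] _ E0.
pose c (i : 'I_d.+1) : K := (i == ord0)%:R.
have ce : \sum_i c i *: e i = e ord0.
  rewrite (bigD1 ord0)//= scale1r big1 ?addr0// => i /negPf i0.
  by rewrite /c i0 scale0r.
have : [set 0] (e ord0) by rewrite -E0; exists c.
rewrite /= -ce => /free /(_ ord0) /eqP.
by rewrite /c eqxx oner_eq0.
Qed.

End dimension.

Lemma dprod_sumE (K : nzRingType) (I : Type) (V : I -> lmodType K) (J : Type)
    (r : seq J) (P : pred J) (F : J -> dprod V) k :
  (\sum_(j <- r | P j) F j : dprod V) k = \sum_(j <- r | P j) F j k.
Proof. by elim/big_rec2: _ => // j y1 y2 _ <-. Qed.

Section pasted_eigenvalue.
Variables (R : realType) (n : nat) (H : 'I_n.+1 -> hilbertType R).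
Local Notation C := R[i].
Variables (S : forall l, set (H l * H l)).
Variables (G : forall l, set ((H l * H l) * (C * C))).
Arguments S : clear implicits.
Arguments G : clear implicits.
Hypotheses (hS : forall l, closed_symmetric (S l))
  (hsimple : forall l, simple_relation (S l))
  (hG : forall l, boundary_relation (S l) (G l))
  (hfun : forall l, function_type (G l))
  (hbf : exists l, boundary_function (G l)).
Variable x : R.

(** The eigenvectors at [x] of the edge [l] with their boundary values, before any
boundary condition is imposed. *)
Definition edge_kernel l (f : H l) (a b : C) : Prop := G l ((f, x%:C *: f), (a, b)).

(** The interface conditions: [a] is the common value of the continuous boundary
components, and the Kirchhoff condition balances the others. *)
Lemma pasted_kernelP (f : dprod H) :
  kernel_sub (pasted_relation G) x%:C f <->
  exists a b, (forall l, edge_kernel (f l) a (b l)) /\ \sum_l b l = 0.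
Proof.
split=> [[q [f' [g [a [b [Gab]]]]]]|[a [b [Gab sb]]]].
  case=> ef eg eq0 _; exists (a ord_max), b.
  have row l : (\row_l (if l == ord_max then \sum_k b k else - a l + a ord_max))
      0 l = 0 by rewrite -eq0 mxE.
  have al l : a l = a ord_max.
    case: (eqVneq l ord_max) => [->//|ln]; apply/eqP.
    by have := row l; rewrite mxE (negPf ln) addrC => /eqP; rewrite subr_eq0 eq_sym.
  split=> [l|]; last by have := row ord_max; rewrite mxE eqxx.
  by rewrite /edge_kernel -(al l); have := Gab l; rewrite -ef -eg.
exists (\row_l (if l == ord_max then - a else - b l)).
exists f, (x%:C *: f), (fun=> a), b; split=> //.
congr (_, (_, _)); apply/rowP => l; rewrite !mxE.
by case: ifP => _; rewrite ?sb ?addNr.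
Qed.

Lemma edge_linear l (c : C) (f g : H l) a b a' b' :
  edge_kernel f a b -> edge_kernel g a' b' ->
  edge_kernel (c *: f + g) (c * a + a') (c * b + b').
Proof.
move=> Kf Kg; have := br_linear (hG l) c Kf Kg; congr G.
by congr pair; congr pair => //=; rewrite scalerDr !scalerA mulrC.
Qed.

Lemma edge0 l : edge_kernel (0 : H l) 0 0.
Proof. by rewrite /edge_kernel scaler0; exact: (br0 (hG l)). Qed.

Lemma edgeZ l (c : C) (f : H l) a b :
  edge_kernel f a b -> edge_kernel (c *: f) (c * a) (c * b).
Proof.
by move=> /(edge_linear c)/(_ (edge0 l)); rewrite !addr0.
Qed.

Lemma edge_boundary l (f g : H l) a b a' b' :
  edge_kernel f a b -> edge_kernel g a' b' -> b * Num.conj a' = a * Num.conj b'.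
Proof. exact: real_kernel_boundary. Qed.

Lemma edge_inj l (f g : H l) a b : edge_kernel f a b -> edge_kernel g a b -> f = g.
Proof. exact: real_kernel_inj. Qed.

(** Guarantees that a nonzero boundary value [(0, b)] on an edge comes with a
nonzero eigenvector. *)
Lemma edge_mul0 l b : edge_kernel (0 : H l) 0 b -> b = 0.
Proof.
rewrite /edge_kernel scaler0 => Gb.
have : (mul_part (G l) `&` [set q | q.1 = 0]) (0, b) by [].
by rewrite hfun => -[].
Qed.

Lemma edge_eigenvalueP l :
  point_spectrum (ker_pi1 (G l)) x%:C <-> exists f : H l, edge_kernel f 0 1.
Proof.
split=> [hx|[f Kf] hx]; last first.
  have : kernel_sub (ker_pi1 (G l)) x%:C f by exists 1.
  rewrite hx => /= f0; have := edge_mul0 (b := 1) (l := l).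
  by rewrite -f0 => /(_ Kf)/eqP; rewrite oner_eq0.
apply: contrapT => hn; apply: hx; apply/seteqP; split=> f /=; last first.
  by move=> ->; exists 0; exact: edge0.
move=> [b Kf]; have [b0|b0] := eqVneq b 0.
  by rewrite b0 in Kf; exact: (edge_inj Kf (edge0 l)).
exfalso; apply: hn; exists (b^-1 *: f).
by have := edgeZ b^-1 Kf; rewrite mulr0 mulVf.
Qed.

Lemma edge_value_neq0 l (f : H l) b : edge_kernel f 0 b -> b != 0 ->
  point_spectrum (ker_pi1 (G l)) x%:C.
Proof.
move=> Kf b0; apply/edge_eigenvalueP; exists (b^-1 *: f).
by have := edgeZ b^-1 Kf; rewrite mulr0 mulVf.
Qed.

Let eig := [pred l | `[< point_spectrum (ker_pi1 (G l)) x%:C >]].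

(** One edge with [x] in its point spectrum forces, by [edge_boundary], the common
value [a] to be zero. An eigenvector of the pasted relation is then a choice of
multiples [c l] of the normalised eigenvectors [phi l] of the edges in [eig] with
[\sum_l c l = 0], a hyperplane; the differences [phi l - phi l0] are a basis. *)
Lemma pasted_multiplicity_poles : (0 < #|eig|)%N ->
  has_multiplicity (pasted_relation G) x%:C (#|eig| - 1).
Proof.
case/card_gt0P => l0 l0eig.
have ex l : exists f : H l, l \in eig -> edge_kernel f 0 1.
  have [|nl] := boolP (l \in eig); last by exists 0.
  by move=> /asboolP/edge_eigenvalueP[f Kf]; exists f.
pose phi : dprod H := fun l => sval (cid (ex l)).
have Kphi l : l \in eig -> edge_kernel (phi l) 0 1 by exact: (svalP (cid (ex l))).
have phi0 l : l \in eig -> phi l != 0.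
  move=> /Kphi Kl; apply: contraTneq isT => p0; rewrite p0 in Kl.
  by have /eqP := edge_mul0 Kl; rewrite oner_eq0.
have kerE f : kernel_sub (pasted_relation G) x%:C f <->
    exists c, [/\ forall l, l \notin eig -> c l = 0, \sum_l c l = 0 &
                  forall l, f l = c l *: phi l].
  rewrite pasted_kernelP; split=> [[a [b [Kf sb]]]|[c [c0 sc fc]]].
    have a0 : a = 0.
      have /esym := edge_boundary (Kf l0) (Kphi _ l0eig).
      by rewrite rmorph1 rmorph0 mulr1 mulr0.
    have b0 l : l \notin eig -> b l = 0.
      move=> ln; apply/eqP; apply: contraNT ln => bl.
      by apply/asboolP; apply: edge_value_neq0 bl; rewrite -a0; exact: Kf.
    exists b; split=> // l; rewrite a0 in Kf.
    apply: (edge_inj (Kf l)).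
    have [le|le] := boolP (l \in eig).
      by have := edgeZ (b l) (Kphi _ le); rewrite mulr0 mulr1.
    by rewrite b0// scale0r; exact: edge0.
  exists 0, c; split=> // l; rewrite fc.
  have [le|le] := boolP (l \in eig).
    by have := edgeZ (c l) (Kphi _ le); rewrite mulr0 mulr1.
  by rewrite c0// scale0r; exact: edge0.
pose Q := [pred l in eig | l != l0].
have -> : (#|eig| - 1 = #|Q|)%N.
  rewrite (cardD1 l0) l0eig addKn; apply: eq_card => l.
  by rewrite !inE andbC.
have Qeig (i : 'I_#|Q|) : enum_val i \in eig.
  by have := enum_valP i; rewrite inE => /andP[].
have Ql0 (i : 'I_#|Q|) : enum_val i != l0.
  by have := enum_valP i; rewrite inE => /andP[].
pose w k l : C := (k == l)%:R - (k == l0)%:R.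
pose e (i : 'I_#|Q|) : dprod H := fun k => w k (enum_val i) *: phi k.
have sumE c k : (\sum_i c i *: e i : dprod H) k =
    (\sum_i c i * w k (enum_val i)) *: phi k.
  by rewrite dprod_sumE scaler_suml; apply: eq_bigr => i _; rewrite -scalerA.
exists e; split=> [c sc j|].
  have := sumE c (enum_val j); rewrite sc.
  rewrite (bigD1 j)//= big1 => [|i ij]; last first.
    rewrite /w (negPf (Ql0 j)) subr0 (inj_eq enum_val_inj) eq_sym (negPf ij).
    by rewrite mulr0.
  rewrite /w eqxx (negPf (Ql0 j)) subr0 mulr1 addr0 => /esym/eqP.
  by rewrite scaler_eq0 (negPf (phi0 _ (Qeig j))) orbF => /eqP.
apply/seteqP; split=> f.
  move=> /kerE[c [c0 sc fc]]; exists (fun i => c (enum_val i)).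
  apply: functional_extensionality_dep => k; rewrite sumE fc; congr (_ *: _).
  rewrite -(big_enum_val (A := Q) (fun l => c l * w k l)) /=.
  (* The Kirchhoff condition recovers the coefficient of [phi l0]. *)
  have sQ : \sum_(l in Q) c l = - c l0.
    apply/eqP; rewrite -addr_eq0 addrC; apply/eqP; rewrite -[RHS]sc [RHS](bigD1 l0)//=.
    congr (_ + _); rewrite big_mkcond [RHS]big_mkcond; apply: eq_bigr => l _.
    rewrite inE andbC; case: (l != l0) => //=.
    by case: ifP => // /negbT/c0.
  under eq_bigr do rewrite mulrBr.
  rewrite big_split /= sumrN -mulr_suml sQ.
  have [->|kl0] := eqVneq k l0.
    rewrite big1 ?add0r ?mulr1 ?opprK// => l; rewrite inE => /andP[_ ll0].
    by rewrite eq_sym (negPf ll0) mulr0.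
  rewrite mulr0 oppr0 addr0; have [kQ|kQ] := boolP (k \in Q).
    rewrite (bigD1 k)//= eqxx mulr1 big1 ?addr0// => l /andP[_ lk].
    by rewrite eq_sym (negPf lk) mulr0.
  rewrite c0; last by apply: contra kQ => ke; rewrite inE ke kl0.
  rewrite big1// => l lQ; case: eqP => [kl|]; last by rewrite mulr0.
  by rewrite kl lQ in kQ.
move=> [c ->]; apply/kerE; exists (fun k => \sum_i c i * w k (enum_val i)).
split=> [l ln||l]; last exact: sumE.
- rewrite big1// => i _; rewrite /w.
  have /negPf -> : l != enum_val i by apply: contraNneq ln => ->.
  have /negPf -> : l != l0 by apply: contraNneq ln => ->.
  by rewrite subrr mulr0.
- rewrite exchange_big big1//= => i _; rewrite -mulr_sumr sumrB.
  have one a : \sum_k (k == a)%:R = 1 :> C.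
    by rewrite (bigD1 a)//= eqxx big1 ?addr0// => k /negPf ->.
  by rewrite !one subrr mulr0.
Qed.

(** Here [edge_boundary] says that the boundary values of an eigenvector on each
edge are a multiple of [(1, b l)], and [edge_inj] that they determine the
eigenvector; the multiple is the same on all edges. The edge whose [G] is a
boundary function guarantees that the eigenvector obtained is not zero. *)
Lemma pasted_multiplicity_value (b : 'I_n.+1 -> R) :
  (forall l, exists f : H l, edge_kernel f 1 (b l)%:C) -> \sum_l b l = 0 ->
  has_multiplicity (pasted_relation G) x%:C 1.
Proof.
move=> ex sb; pose f : dprod H := fun l => sval (cid (ex l)).
have Kf l : edge_kernel (f l) 1 (b l)%:C by exact: (svalP (cid (ex l))).
have f0 : f <> 0.
  case: hbf => l bl fe; have fl : f l = 0 by rewrite fe.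
  have := Kf l; rewrite fl /edge_kernel scaler0 => Gb.
  have : mul_part (G l) (1, (b l)%:C) by [].
  by rewrite bl => -[] /eqP; rewrite oner_eq0.
exists (fun=> f); split=> [c|].
  rewrite big_ord_recl big_ord0 addr0 => /eqP; rewrite scaler_eq0 => /orP[/eqP c0|/eqP//].
  by move=> i; rewrite ord1.
apply/seteqP; split=> g.
  move=> /pasted_kernelP[a [b' [Kg _]]]; exists (fun=> a).
  rewrite big_ord_recl big_ord0 addr0; apply: functional_extensionality_dep => l.
  apply: (edge_inj (Kg l)).
  have := edge_boundary (Kg l) (Kf l); rewrite rmorph1 mulr1 conjC_real => ->.
  by have := edgeZ a (Kf l); rewrite mulr1.
move=> [c ->]; rewrite big_ord_recl big_ord0 addr0.
apply/pasted_kernelP; exists (c ord0), (fun l => c ord0 * (b l)%:C); split=> [l|].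
  by have := edgeZ (c ord0) (Kf l); rewrite mulr1.
by rewrite -mulr_sumr -rmorph_sum sb rmorph0 mulr0.
Qed.

(** If the common value [a] of an eigenvector vanishes, the second boundary values
are not all zero and have sum zero, so at least two edges contribute; otherwise
normalise [a] to one. *)
Lemma pasted_eigenvalue_cases : point_spectrum (pasted_relation G) x%:C ->
  (2 <= #|eig|)%N \/
  exists b : 'I_n.+1 -> R,
    (forall l, exists f : H l, edge_kernel f 1 (b l)%:C) /\ \sum_l b l = 0.
Proof.
move=> hx.
have [f Kf f0] : exists2 f, kernel_sub (pasted_relation G) x%:C f & f <> 0.
  apply: contrapT => hn; apply: hx; apply/seteqP; split=> f /=.
    by move=> Kf; apply: contrapT => f0; apply: hn; exists f.
  move=> ->; apply/pasted_kernelP; exists 0, (fun=> 0); split=> [l|].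
    exact: edge0.
  by rewrite big1.
have [a [b [Kab sb]]] := (pasted_kernelP f).1 Kf.
have [a0|a0] := eqVneq a 0; [left|right].
  rewrite a0 in Kab.
  have bn0 l : b l != 0 -> l \in eig.
    by move=> bl; apply/asboolP; exact: edge_value_neq0 (Kab l) bl.
  have [l bl] : exists l, b l != 0.
    apply: contrapT => hn; apply: f0; apply: functional_extensionality_dep => l.
    apply: (edge_inj (Kab l)).
    have -> : b l = 0; last exact: edge0.
    by apply: contrapT => /eqP bl; apply: hn; exists l.
  have [k /andP[kl bk]] : exists k, (k != l) && (b k != 0).
    apply: contrapT => hn; move: sb; rewrite (bigD1 l)//= big1 => [|k kl].
      by rewrite addr0 => /eqP; rewrite (negPf bl).
    by apply/eqP; apply: contrapT => /negP bk; apply: hn; exists k; rewrite kl.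
  by apply/card_gt1P; exists k, l; split => //; exact: bn0.
have K1 l : edge_kernel (a^-1 *: f l) 1 (a^-1 * b l).
  by have := edgeZ a^-1 (Kab l); rewrite mulVf.
have re l : a^-1 * b l = (complex.Re (a^-1 * b l))%:C.
  have := edge_boundary (K1 l) (K1 l); rewrite rmorph1 mulr1 mul1r.
  move=> /(congr1 (@complex.Im R)); rewrite Im_conjC => h.
  by apply: complex_eqP => //=; lra.
exists (fun l => complex.Re (a^-1 * b l)); split=> [l|].
  by exists (a^-1 *: f l); rewrite -re.
by rewrite -raddf_sum -mulr_sumr sb mulr0.
Qed.

End pasted_eigenvalue.

Theorem theorem3p19 (R : realType) (n : nat) (hn : (2 <= n.+1)%N)
    (H : 'I_n.+1 -> hilbertType R)
    (S : forall l, set (H l * H l))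
    (G : forall l, set ((H l * H l) * (R[i] * R[i])))
    (m : 'I_n.+1 -> R[i] -> R[i])
    (hS : forall l, closed_symmetric (S l))
    (hsimple : forall l, simple_relation (S l))
    (hG : forall l, boundary_relation (S l) (G l))
    (hfun : forall l, function_type (G l))
    (hbf : exists l, boundary_function (G l))
    (hm : forall l, weyl_function (G l) (m l))
    (x : R) :
  let A := pasted_relation G in
  let nA := #|[pred l | `[< point_spectrum (ker_pi1 (G l)) x%:C >]]| in
  let nm := #|[pred l | `[< exists2 v : R, 0 < v &
      e * complex.Im (m l (x +i* e)) @[e --> 0^'+] --> v >]]| in
  let caseI_II := (2 <= nA)%N in
  let caseIII := exists mx : 'I_n.+1 -> R,
    [/\ forall l, m l (x +i* e) @[e --> 0^'+] --> (mx l)%:C,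
        forall l, exists2 d : R, 0 <= d &
          (m l (x +i* e) - (mx l)%:C) / ('i%C * e%:C) @[e --> 0^'+] --> d%:C &
        \sum_l mx l = 0] in
  [/\ point_spectrum A x%:C <-> caseI_II \/ caseIII,
      caseI_II -> has_multiplicity A x%:C (nA - 1) /\ (nA - 1 = nm - 1)%N &
      caseIII -> has_multiplicity A x%:C 1].
Proof.
move=> A nA nm caseI_II caseIII.
have nAm : nA = nm.
  apply: eq_card => l; apply: asbool_equiv_eq.
  exact: (pole_point_spectrum (hS l) (hsimple l) (hG l) (hm l) x).
have value l (b : R) :=
  real_kernel_value (hS l) (hsimple l) (hG l) (hm l) x b.
have III : caseIII <-> exists b : 'I_n.+1 -> R,
    (forall l, exists f : H l, edge_kernel G x f 1 (b l)%:C) /\ \sum_l b l = 0.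
  split=> [[b [mb qb sb]]|[b [Kb sb]]]; exists b; split=> //.
  - by move=> l; apply/value; split.
  - by move=> l; have /value[] := Kb l.
  - by move=> l; have /value[] := Kb l.
have multI : caseI_II -> has_multiplicity A x%:C (nA - 1).
  by move=> h; apply: (pasted_multiplicity_poles hS hsimple hG hfun); exact: ltnW.
have multIII : caseIII -> has_multiplicity A x%:C 1.
  by move=> /III[b [Kb sb]]; exact: (pasted_multiplicity_value hS hsimple hG hbf Kb sb).
split=> // [|h]; last by rewrite -nAm; split => //; exact: multI.
split=> [hx|[h|h]].
- have [|h] := pasted_eigenvalue_cases hS hsimple hG hfun hx; first by left.
  by right; apply/III.
- by apply: (has_dim_gt0_neq0 (multI h)); rewrite subn_gt0.
- exact: (has_dim_gt0_neq0 (multIII h)).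
Qed.
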